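(* Let $k\ge1$ and let $\mathcal M:\mathcal H\to\mathcal Y$ be Fréchet differentiable near $z^\star\in\mathcal H$, with Jacobian $J_\star=D\mathcal M(z^\star)$. Suppose there exist $L\ge0$ and $r>0$ such that for every $h\in\mathcal H$ with $\|h\|_{0,\mathrm g}\le2k$ and $\|h\|_2\le r$, $$\|\mathcal M(z^\star+h)-\mathcal M(z^\star)-J_\star h\|_2\le\frac L2\|h\|_2^2.$$ If $\gamma_k(J_\star)>Lr/2$, then for every nonzero $h$ with $\|h\|_{0,\mathrm g}\le2k$ and $\|h\|_2\le r$, $$\|\mathcal M(z^\star+h)-\mathcal M(z^\star)\|_2\ge\Bigl(\gamma_k(J_\star)-\frac{Lr}{2}\Bigr)\|h\|_2>0.$$ Hence $\mathcal M(z^\star+h)\neq\mathcal M(z^\star)$ for all such $h$, i.e. $\mathcal M$ is injective from $z^\star$ along this sparse neighborhood.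
   Context: Let $V=\{1,\dots,n\}$, let $\mathcal H_i$ ($i\in V$) be finite-dimensional real Hilbert spaces, $\mathcal H=\bigoplus_{i\in V}\mathcal H_i$ (with $\mathcal H\ne\{0\}$) with $\|h\|_2^2=\sum_i\|h_i\|_2^2$, and group sparsity $\|h\|_{0,\mathrm g}=|\{i:h_i\neq0\}|$. $\mathcal Y$ is a finite-dimensional real Hilbert space. The restricted Jacobian margin is $$\gamma_k(J_\star)=\min_{0<\|h\|_{0,\mathrm g}\le2k}\frac{\|J_\star h\|_2}{\|h\|_2}.$$ In the application $\mathcal M$ stacks nonlinear relation residuals and anchor residuals. *)

(* Defs.v *)
From HB Require Import structures.
From mathcomp Require Import all_boot all_order all_algebra.
From mathcomp Require Import all_classical all_reals all_analysis.
From mathcomp Require Import ring lra.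
Set Implicit Arguments.
Unset Strict Implicit.
Unset Printing Implicit Defensive.
Import Order.TTheory GRing.Theory Num.Theory.
Import numFieldNormedType.Exports.
Import VectorInternalTheory.
Local Open Scope classical_set_scope.
Local Open Scope ring_scope.

HB.mixin Record NormedModule_isHilbert (R : realType) (V : Type)
    & NormedModule R V & Vector R V := {
  inner : {dot V for idfun};
  sqr_normE : forall u : V, `|u| ^+ 2 = inner u u }.

#[short(type="finHilbertType")]
HB.structure Definition FinHilbert (R : realType) :=
  {V of NormedModule R V & Vector R V & NormedModule_isHilbert R V}.

(* The external direct sum, with ||h||^2 = \sum_i ||h_i||^2. *)
Definition hsum (R : realType) (n : nat) (Hs : 'I_n -> finHilbertType R) : Type :=
  {dffun forall i, Hs i}.

Section DirectSum.
Context (R : realType) (n : nat) (Hs : 'I_n -> finHilbertType R).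
Local Notation H := (hsum Hs).
Implicit Types (u v w : H) (a : R).

HB.instance Definition _ := Choice.copy H {dffun forall i, Hs i}.

Let hzero : H := [ffun i => 0 : Hs i].
Let hopp u : H := [ffun i => - u i].
Let hadd u v : H := [ffun i => u i + v i].
Let hscale a u : H := [ffun i => a *: u i].

Let haddA : associative hadd.
Proof. by move=> u v w; apply/ffunP => i; rewrite !ffunE addrA. Qed.
Let haddC : commutative hadd.
Proof. by move=> u v; apply/ffunP => i; rewrite !ffunE addrC. Qed.
Let hadd0 : left_id hzero hadd.
Proof. by move=> u; apply/ffunP => i; rewrite !ffunE add0r. Qed.
Let haddN : left_inverse hzero hopp hadd.
Proof. by move=> u; apply/ffunP => i; rewrite !ffunE addNr. Qed.

HB.instance Definition _ := GRing.isZmodule.Build H haddA haddC hadd0 haddN.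

Let hscaleA a b u : hscale a (hscale b u) = hscale (a * b) u.
Proof. by apply/ffunP => i; rewrite !ffunE scalerA. Qed.
Let hscale1 : left_id 1 hscale.
Proof. by move=> u; apply/ffunP => i; rewrite !ffunE scale1r. Qed.
Let hscaleDr : right_distributive hscale +%R.
Proof. by move=> a u v; apply/ffunP => i; rewrite !ffunE scalerDr. Qed.
Let hscaleDl u : {morph hscale^~ u : a b / a + b}.
Proof. by move=> a b; apply/ffunP => i; rewrite !ffunE scalerDl. Qed.

HB.instance Definition _ :=
  GRing.Zmodule_isLmodule.Build R H hscaleA hscale1 hscaleDr hscaleDl.

Lemma hsum0E i : (0 : H) i = 0. Proof. by rewrite ffunE. Qed.
Lemma hsumDE u v i : (u + v) i = u i + v i. Proof. by rewrite ffunE. Qed.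
Lemma hsumZE a u i : (a *: u) i = a *: u i. Proof. by rewrite ffunE. Qed.

Definition hsum_inner u v : R := \sum_i inner (u i) (v i).

Let hinner_bilinear : bilinear_for *%R (idfun \; *%R) hsum_inner.
Proof.
split=> [v a u w|u a v w]; rewrite /hsum_inner /= mulr_sumr -big_split /=.
  by apply: eq_bigr => i _; rewrite hsumDE hsumZE linearPl.
by apply: eq_bigr => i _; rewrite hsumDE hsumZE linearPr.
Qed.

HB.instance Definition _ :=
  bilinear_isBilinear.Build R H H R *%R (idfun \; *%R) hsum_inner
    hinner_bilinear.

Let hinner_sym u v : hsum_inner u v = (-1) ^+ false * idfun (hsum_inner v u).
Proof.
rewrite expr0 mul1r /=; apply: eq_bigr => i _.
by rewrite hermC /= mul1r.
Qed.

HB.instance Definition _ :=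
  isHermitianSesquilinear.Build R H false idfun hsum_inner hinner_sym.

Let hinner_sqr u : hsum_inner u u = \sum_i `|u i| ^+ 2.
Proof. by apply: eq_bigr => i _; rewrite sqr_normE. Qed.

Let hinner_ge0 u : 0 <= hsum_inner u u.
Proof. by rewrite hinner_sqr sumr_ge0// => i _; rewrite sqr_ge0. Qed.

Let hinner_eq0 u : hsum_inner u u = 0 -> u = 0.
Proof.
move=> /eqP; rewrite hinner_sqr psumr_eq0; last by move=> i _; rewrite sqr_ge0.
move=> /allP u0; apply/ffunP => i; rewrite hsum0E.
by have := u0 i (mem_index_enum i); rewrite sqrf_eq0 normr_eq0 => /eqP.
Qed.

Let hinner_gt0 u : u != 0 -> 0 < hsum_inner u u.
Proof.
by move=> u0; rewrite lt_def hinner_ge0 andbT; apply: contra_neq u0 => /hinner_eq0.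
Qed.

HB.instance Definition _ := isDotProduct.Build R H hsum_inner hinner_gt0.

Definition hsum_norm u : R := Num.sqrt (\sum_i `|u i| ^+ 2).

Let hnorm_sqr u : hsum_norm u ^+ 2 = hsum_inner u u.
Proof. by rewrite sqr_sqrtr ?hinner_sqr// -hinner_sqr. Qed.

Let hCS u v : hsum_inner u v <= hsum_norm u * hsum_norm v.
Proof.
rewrite (le_trans (ler_norm _))// -ler_sqr ?nnegrE ?mulr_ge0 ?sqrtr_ge0//.
rewrite exprMn !hnorm_sqr real_normK ?num_real//.
have [->|u0] := eqVneq u 0.
  by rewrite linear0l expr0n mulr_ge0.
have A0 := hinner_gt0 u0.
have := hinner_ge0 (hsum_inner u u *: v - hsum_inner u v *: u).
rewrite linearBl !linearBr !linearZl_LR !linearZr_LR /=.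
rewrite [hsum_inner v u]hinner_sym expr0 mul1r /=.
set A := hsum_inner u u; set B := hsum_inner u v; set C := hsum_inner v v.
have -> : A * (A * C) - A * (B * B) - (B * (A * B) - B * (B * A)) =
  A * (A * C - B ^+ 2) by ring.
by rewrite pmulr_rge0// subr_ge0.
Qed.

Let hnormD u v : hsum_norm (u + v) <= hsum_norm u + hsum_norm v.
Proof.
rewrite -ler_sqr ?nnegrE ?addr_ge0 ?sqrtr_ge0// sqrrD !hnorm_sqr.
rewrite linearDl !linearDr /= [hsum_inner v u]hinner_sym expr0 mul1r /=.
have := hCS u v; lra.
Qed.

Let hnormZ a u : hsum_norm (a *: u) = `|a| * hsum_norm u.
Proof.
rewrite /hsum_norm -sqrtr_sqr -sqrtrM ?sqr_ge0// mulr_sumr.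
by congr Num.sqrt; apply: eq_bigr => i _; rewrite hsumZE normrZ exprMn real_normK ?num_real.
Qed.

Let hnorm_eq0 u : hsum_norm u = 0 -> u = 0.
Proof. by move=> u0; apply: hinner_eq0; rewrite -hnorm_sqr u0 expr0n. Qed.

HB.instance Definition _ :=
  Lmodule_isNormed.Build R H hnormD hnormZ hnorm_eq0.

Let hsum_vect_iso : Vector.axiom (\sum_i dim (Hs i))%N H.
Proof.
exists (fun u => \mxrow_i v2r (u i)).
  by move=> a u v; apply/rowP => j; rewrite !mxE hsumDE hsumZE linearP !mxE.
exists (fun r => [ffun i => r2v (submxrow r i)] : H) => [u|r].
  by apply/ffunP => i; rewrite ffunE mxrowK v2rK.
by apply/mxrowP => i; rewrite mxrowK ffunE r2vK.
Qed.

HB.instance Definition _ := Lmodule_hasFinDim.Build R H hsum_vect_iso.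

Let hsum_sqr_norm u : `|u| ^+ 2 = hsum_inner u u.
Proof. exact: hnorm_sqr. Qed.

HB.instance Definition _ := NormedModule_isHilbert.Build R H hsum_sqr_norm.

Lemma hsum_normE u : `|u| = Num.sqrt (\sum_i `|u i| ^+ 2).
Proof. by []. Qed.

End DirectSum.

Definition group_norm0 (R : realType) (n : nat) (Hs : 'I_n -> finHilbertType R)
  (h : hsum Hs) : nat := #|[pred i | h i != 0]|.

(* For nonzero [hsum Hs] and [0 < k] the infimum is attained, i.e. it is the
   minimum: see [restricted_margin_min] below. *)
Definition restricted_margin (R : realType) (n : nat)
    (Hs : 'I_n -> finHilbertType R) (Y : finHilbertType R) (k : nat)
    (J : {linear hsum Hs -> Y}) : R :=
  inf [set `|J h| / `|h| |
       h in [set h : hsum Hs | (0 < group_norm0 h <= 2 * k)%N]].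

Section MarginMin.
Context (R : realType) (n : nat) (Hs : 'I_n -> finHilbertType R).
Local Notation H := (hsum Hs).

Lemma group_norm0_gt0 (h : H) : (0 < group_norm0 h)%N = (h != 0).
Proof.
apply/card_gt0P/idP => [[i]|]; rewrite ?inE.
  by apply: contra_neq => ->; rewrite hsum0E.
move=> h0; have [[i hi]|hn] := pselect (exists i, h i != 0).
  by exists i; rewrite inE.
case/eqP: h0; apply/ffunP => i; rewrite hsum0E; apply/eqP.
by apply: contra_notT hn => hi; exists i.
Qed.

Lemma group_norm0Z (a : R) (h : H) :
  a != 0 -> group_norm0 (a *: h) = group_norm0 h.
Proof.
move=> a0; apply: eq_card => i.
by rewrite !inE hsumZE scaler_eq0 (negbTE a0).
Qed.

Let rV_linear_continuous (m : nat) (W : normedModType R)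
  (f : 'rV[R]_m -> W) : linear f -> continuous f.
Proof.
move=> flin.
have f_is_linear := GRing.isLinear.Build R 'rV[R]_m W *:%R f flin.
pose fL : {linear 'rV[R]_m -> W} := HB.pack f f_is_linear.
rewrite -[f]/(fL : _ -> _).
move: fL => {flin f_is_linear}f0; move: f0 => {}f.
have -> : f = (fun x : 'rV[R]_m => \sum_j x 0 j *: f 'e_j) :> (_ -> _).
  apply/funext => x; rewrite {1}(row_sum_delta x) linear_sum.
  by apply: eq_bigr => j _; rewrite linearZ.
move=> x.
apply: (@cvg_big W _ +%R 0 _ _ _ (nbhs x) _ (fun j (y : 'rV_m) => y 0 j *: f 'e_j)
  (fun j => x 0 j *: f 'e_j)).
  exact: add_continuous.
move=> j _.
apply: (@cvgZr_tmp R W _ (nbhs x) _ (fun y : 'rV_m => y 0 j)).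
exact: coord_continuous.
Qed.

Variables (Y : finHilbertType R) (k : nat) (J : {linear hsum Hs -> Y}).
Local Notation dimH := (dim (H : vectType R)).

Lemma restricted_margin_min : (0 < k)%N -> (exists h : H, h != 0) ->
  let S := [set `|J h| / `|h| |
            h in [set h : H | (0 < group_norm0 h <= 2 * k)%N]] in
  S (restricted_margin k J) /\ lbound S (restricted_margin k J).
Proof.
move=> k0 [h0 h0n0] S.
pose g : {linear 'rV[R]_dimH -> H} := r2v.
have g_eq0 x : (g x == 0) = (x == 0).
  by rewrite -[0 in LHS](linear0 g) (can_eq (@r2vK _ _)).
pose K := [set x : 'rV[R]_dimH | `|x| = 1 /\ (group_norm0 (g x) <= 2 * k)%N].
have K_neq0 x : K x -> x != 0 by move=> [x1 _]; rewrite -normr_eq0 x1 oner_neq0.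
pose F (x : 'rV[R]_dimH) : R := `|J (g x)| / `|g x|.
have SK : S = [set F x | x in K].
  apply/seteqP; split => [_ [h /= /andP[hn0 hk] <-]|_ [x Kx <-]]; last first.
    exists (g x) => //=; rewrite group_norm0_gt0 g_eq0 K_neq0//.
    by case: Kx.
  rewrite group_norm0_gt0 in hn0.
  have vh0 : `|v2r h| != 0.
    by rewrite normr_eq0 -g_eq0 /g/= v2rK.
  exists (`|v2r h|^-1 *: v2r h); rewrite /K /F /= linearZ /= v2rK.
    rewrite group_norm0Z ?invr_eq0//; split => //.
    by rewrite normrZ normfV normr_id mulVf.
  rewrite linearZ /= !normrZ invfM mulrACA divff ?mul1r//.
  by rewrite normr_eq0 invr_eq0.
have K_neq : K !=set0.
  have [i hi] : exists i, h0 i != 0.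
    by move: h0n0; rewrite -group_norm0_gt0 => /card_gt0P[i]; exists i.
  pose h : H := [ffun j => if j == i then h0 j else 0].
  have hD : [set h : H | (0 < group_norm0 h <= 2 * k)%N] h.
    rewrite /= group_norm0_gt0; apply/andP; split.
      by apply: contra_neq hi => /ffunP/(_ i); rewrite !ffunE eqxx.
    apply: (@leq_trans 1%N); last by rewrite muln_gt0.
    rewrite -(card1 i) subset_leq_card//; apply/fintype.subsetP => j.
    by rewrite !inE ffunE; case: (j == i) => //; rewrite eqxx.
  have : S (`|J h| / `|h|) by exists h.
  by rewrite SK => -[x Kx _]; exists x.
have gc : continuous g by apply: rV_linear_continuous => a x y; rewrite linearP.
have Jgc : continuous (J \o g) by apply: rV_linear_continuous => a x y; rewrite /= !linearP.
have K_compact : compact K.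
  apply: bounded_closed_compact.
    by exists 1; split => // M M1 x [x1 _] /=; rewrite x1 ltW.
  rewrite (_ : K = [set x | `|x| = 1] `&`
    [set x | (group_norm0 (g x) <= 2 * k)%N])//.
  apply: closedI.
    apply: (@closed_comp _ _ (fun x : 'rV[R]_dimH => `|x|) [set 1 : R]).
      by move=> x _; exact: norm_continuous.
    exact: closed_eq.
  rewrite -openC openE => x /= /negP; rewrite -ltnNge => kx.
  have : \forall y \near x, forall i, g x i != 0 -> g y i != 0.
    apply: (@filter_forall _ _ (fun i y => g x i != 0 -> g y i != 0) (nbhs x)).
    move=> i.
    have [xi0|xi0] := eqVneq (g x i) 0; first by near=> y.
    have gic : continuous (fun y => g y i).
      by apply: rV_linear_continuous => a u v; rewrite linearP hsumDE hsumZE.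
    by near=> y => _; near: y; exact: cvgr_neq0 (gic x) xi0.
  move=> yx; near=> y => /=; apply/negP; rewrite -ltnNge (leq_trans kx)//.
  have yi : forall i, g x i != 0 -> g y i != 0 by near: y; exact: yx.
  by apply/subset_leq_card/fintype.subsetP => i; rewrite !inE; exact: yi.
have Fc : {within K, continuous F}.
  rewrite continuous_subspace_in => x; rewrite inE => Kx.
  have gx0 : `|g x| != 0 by rewrite normr_eq0 g_eq0 K_neq0.
  apply: continuous_subspaceT_for => //.
  apply: continuousM.
    by apply: (continuous_comp (Jgc x)); exact: norm_continuous.
  apply: continuousV => //.
  by apply: (continuous_comp (gc x)); exact: norm_continuous.
have [c cK cmin] := EVT_min_rV K_neq K_compact Fc.
rewrite inE in cK.
have Sc : S (F c) by rewrite SK; exists c.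
have lbc : lbound S (F c).
  by rewrite SK => _ [x Kx <-]; apply: cmin; rewrite inE.
suff -> : restricted_margin k J = F c by [].
apply/eqP; rewrite eq_le; apply/andP; split.
  by apply: inf_lbound => //; exists (F c).
by apply: lb_le_inf => //; exists (F c).
Unshelve. all: by end_near. Qed.

End MarginMin.

(* Main.v *)
Require Import Defs.
From mathcomp Require Import all_boot all_order all_algebra.
From mathcomp Require Import all_classical all_reals all_analysis.
Import Order.TTheory GRing.Theory Num.Theory.
Import numFieldNormedType.Exports.
Local Open Scope classical_set_scope.
Local Open Scope ring_scope.

(** On a [2 * k]-sparse [h] the linear part is large: [restricted_margin_le] bounds [|J h|] below by
    the margin times [|h|]. The remainder is small: a quadratic bound becomes linear with slope
    [L * r / 2] once [|h| <= r]. The reverse triangle inequality subtracts the two, and the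
    surviving slope is positive by hypothesis, so the increment of [M] cannot vanish. *)

Lemma restricted_margin_le (R : realType) (n : nat)
    (Hs : 'I_n -> finHilbertType R) (Y : finHilbertType R) (k : nat)
    (J : {linear hsum Hs -> Y}) (h : hsum Hs) :
  (group_norm0 h <= 2 * k)%N -> restricted_margin k J * `|h| <= `|J h|.
Proof.
(* The zero vector gives no quotient under the infimum, so it is treated apart. *)
have [-> _|h0 hk] := eqVneq h 0; first by rewrite normr0 mulr0.
rewrite -ler_pdivlMr ?normr_gt0//; apply: ge_inf.
  (* [ge_inf] needs a lower bound of the set: quotients of norms are nonnegative. *)
  by exists 0 => _ [u _ <-]; rewrite divr_ge0.
by exists h => //=; rewrite group_norm0_gt0 h0.
Qed.

Theorem theorem25 (R : realType) (n : nat) (Hs : 'I_n -> finHilbertType R)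
  (Y : finHilbertType R) (hH : exists h : hsum Hs, h != 0)
  (k : nat) (hk : (1 <= k)%N) (M : hsum Hs -> Y) (zstar : hsum Hs)
  (hdiff : \forall z \near zstar, differentiable M z)
  (L r : R) (hL : 0 <= L) (hr : 0 < r)
  (hM : forall h : hsum Hs, (group_norm0 h <= 2 * k)%N -> `|h| <= r ->
     `|M (zstar + h) - M zstar - 'd M zstar h| <= L / 2 * `|h| ^+ 2)
  (hgamma : restricted_margin k ('d M zstar) > L * r / 2) :
  forall h : hsum Hs, h != 0 -> (group_norm0 h <= 2 * k)%N -> `|h| <= r ->
    [/\ `|M (zstar + h) - M zstar| >=
          (restricted_margin k ('d M zstar) - L * r / 2) * `|h|,
        (restricted_margin k ('d M zstar) - L * r / 2) * `|h| > 0
      & M (zstar + h) <> M zstar].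
Proof.
move=> h h0 h2k hler; have h_gt0 : 0 < `|h| by rewrite normr_gt0.
have pos : 0 < (restricted_margin k ('d M zstar) - L * r / 2) * `|h|.
  by rewrite mulr_gt0 ?subr_gt0.
have low : (restricted_margin k ('d M zstar) - L * r / 2) * `|h| <=
    `|M (zstar + h) - M zstar|.
  (* Only one of the two factors [|h|] is traded for [r], which needs [0 <= L]. *)
  have rem : L / 2 * `|h| ^+ 2 <= L * r / 2 * `|h|.
    rewrite expr2 mulrA ler_wpM2r// mulrAC ler_wpM2r ?invr_ge0//.
    by rewrite ler_wpM2l.
  have J_le := restricted_margin_le _ _ _ _ _ ('d M zstar) _ h2k.
  have M_le := le_trans (hM h h2k hler) rem.
  (* Reverse triangle inequality: [|J h|] exceeds the norm of the increment by at most the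
     remainder. *)
  have tri := lerB_dist ('d M zstar h) (M (zstar + h) - M zstar).
  rewrite distrC in tri.
  rewrite mulrBl lerBlDr (le_trans J_le)// -lerBlDl.
  exact: le_trans tri M_le.
split=> // eqM; have := lt_le_trans pos low.
by rewrite eqM subrr normr0 ltxx.
Qed.
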